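(* Let $\alpha\in(0,1)$, and let $A(z)=A_0+\sum_{m=1}^\infty A_mz^m$, where $A_m$ are $n\times n$ complex matrices with $\|A_m\|\le M\mu^m$, $m=0,1,2,\ldots$, for some constants $M>0$, $\mu>0$. If a formal series $$u(t)=\sum_{k=0}^\infty u_kt^{\alpha k},\qquad u_k\in\mathbb C^n,$$ is a formal solution of the system $t^\alpha\left(D_{0+}^\alpha u\right)(t)=A(t^\alpha)u(t)$, then this series is absolutely convergent on some neighbourhood of the origin (i.e. for all $t\in[0,\varepsilon)$ with some $\varepsilon>0$).
   Context: $D_{0+}^\alpha$ is the Riemann-Liouville fractional derivative of order $\alpha$, $\left(D_{0+}^\alpha\varphi\right)(t)=\frac1{\Gamma(1-\alpha)}\frac{d}{dt}\int_0^t(t-\tau)^{-\alpha}\varphi(\tau)\,d\tau$; on powers, $D_{0+}^\alpha t^d=\frac{\Gamma(d+1)}{\Gamma(d+1-\alpha)}t^{d-\alpha}$ for $d>-1$. Put $$\beta(l)=\frac{\Gamma(l\alpha+1)}{\Gamma(l\alpha+1-\alpha)},\qquad l=0,1,2,\ldots .$$ The formal series $\sum_{k\ge0}u_kt^{\alpha k}$ is called a formal solution of the system if the relations obtained by formal termwise substitution hold, that is $$A_0u_0=\frac1{\Gamma(1-\alpha)}u_0,\qquad \left[A_0-\beta(l)\right]u_l=-\sum_{k=1}^lA_ku_{l-k},\quad l\ge1,$$ where $\beta(l)$ stands for $\beta(l)$ times the identity matrix. *)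

(* Defs.v *)
From mathcomp Require Import all_boot all_order all_algebra.
From mathcomp Require Import complex.
From mathcomp Require Import all_classical all_reals all_analysis.

Set Implicit Arguments.
Unset Strict Implicit.
Unset Printing Implicit Defensive.

Import Order.TTheory GRing.Theory Num.Theory.
Import numFieldNormedType.Exports.

Local Open Scope ring_scope.
Local Open Scope complex_scope.

(* Euler's integral; it represents the Gamma function only for [0 < x]. *)
Definition Gamma (R : realType) (x : R) : R :=
  Rintegral (@lebesgue_measure R) `]0, +oo[%classic
    (fun t => t `^ (x - 1) * expR (- t)).

(* The coefficient in D^alpha t^(alpha l) = beta(l) t^(alpha l - alpha), where
   D^alpha is the Riemann-Liouville derivative.  For [0 < alpha < 1] both
   arguments of [Gamma] are positive, including when [l = 0]. *)
Definition beta (R : realType) (alpha : R) (l : nat) : R :=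
  Gamma (l%:R * alpha + 1) / Gamma (l%:R * alpha + 1 - alpha).

(* The library norm [`|B|], i.e. the largest modulus of an entry, is typed in
   [R[i]]; it is a nonnegative real, so its real part carries all of it. *)
Definition cmx_norm (R : realType) (p q : nat) (B : 'M[R[i]]_(p, q)) : R :=
  complex.Re `|B|.

(* The series sum_k u_k t^(alpha k) solves t^alpha D^alpha u = A(t^alpha) u
   formally, where A(z) = sum_m A_m z^m: the coefficients of t^(alpha l) on the
   two sides agree for every l. *)
Definition formal_solution (R : realType) (alpha : R) (n : nat)
    (A : nat -> 'M[R[i]]_n) (u : nat -> 'cV[R[i]]_n) : Prop :=
  A 0%N *m u 0%N = ((Gamma (1 - alpha))^-1)%:C *: u 0%N /\
  forall l : nat, (1 <= l)%N ->
    (A 0%N - ((beta alpha l)%:C)%:M) *m u l =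
      - \sum_(1 <= k < l.+1) A k *m u (l - k)%N.

(* Absolute convergence at [t] of sum_k u_k t^(alpha k), for [0 <= t].  At
   [t = 0] the library convention [0 `^ 0 = 1] makes the k = 0 term [u_0]. *)
Definition abs_convergent_at (R : realType) (alpha : R) (n : nat)
    (u : nat -> 'cV[R[i]]_n) (t : R) : Prop :=
  cvgn (series (fun k : nat =>
    cmx_norm ((t `^ (alpha * k%:R))%:C *: u k))).

(* Main.v *)
Require Import Defs.
From mathcomp Require Import all_boot all_order all_algebra.
From mathcomp Require Import complex.
From mathcomp Require Import all_classical all_reals all_analysis.
From mathcomp Require Import measurable_realfun ring lra.

Import Order.TTheory GRing.Theory Num.Theory.
Import numFieldNormedType.Exports.

Local Open Scope ring_scope.
Local Open Scope complex_scope.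

(** The coefficients satisfy [beta(l) u_l = A_0 u_l + sum_k A_k u_(l-k)], where
    [k] runs from 1 to [l].  Convergence comes from the growth
    [beta(l) -> +oo]: as soon as [beta(l)] exceeds [2 C + 1], with [C = n M] and [n] the dimension, the term [A_0 u_l] is
    absorbed by the left-hand side, leaving the scalar recursion
    [|u_l| <= sum_k mu^k |u_(l-k)|].  Since the [2^(-k)] with [k >= 1] sum
    to at most [1], an induction gives [|u_l| <= K (2 mu)^l]
    ([geometric_bound_of_convolution]), so the series is dominated by a
    geometric one as long as [2 mu t^alpha < 1].

    That [beta] is unbounded is [Gamma_shift_eventually_ge]: for fixed [B],
    [B Gamma(x) <= Gamma(x + alpha)] when [x = k alpha + 1] is large.  One integrates
    [(t^alpha - B) t^q e^(-t)] with [q = x - 1].  It is negative only for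
    [t < T], where [T^alpha = B], and there its size is at most [B T^q]; on a
    unit interval to the right of [S], where [S^alpha = 2 B], it is at least
    [B S^q e^(-(S+1))].  As [S > T], the positive part wins for large [q]. *)

(** * The Gamma integral *)

Definition gamma_integrand {R : realType} (q t : R) : R :=
  t `^ q * expR (- t).

Lemma gamma_integrand_ge0 {R : realType} (q t : R) : 0 <= gamma_integrand q t.
Proof. by rewrite mulr_ge0 ?powR_ge0 ?expR_ge0. Qed.

Lemma measurable_gamma_integrand {R : realType} (q : R) :
  measurable_fun [set: R] (gamma_integrand q).
Proof.
apply: measurable_funM; first exact: measurable_powR.
by apply: measurableT_comp; [exact: measurable_expR|exact: oppr_measurable].
Qed.

(** Integrability has to be established before any estimate, because [Gamma]
    would take the value [0] at a point where its integral diverges.  The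
    integrand is dominated by a multiple of [e^(-t/2)], as [t^q] is bounded by
    a multiple of [e^(t/2)]. *)
Lemma integrable_gamma_integrand {R : realType} (q : R) : 0 <= q ->
  (@lebesgue_measure R).-integrable `]0, +oo[%classic
    (EFin \o gamma_integrand q).
Proof.
move=> q0.
pose N := `|Num.ceil q|%N.
have qN : q <= N.+1%:R.
  rewrite (le_trans (Num.Theory.ceil_ge q))//.
  rewrite -[N.+1%:R]/((N.+1%:Z)%:~R) ler_int.
  by rewrite (le_trans (ler_norm _))// -abszE lez_nat.
(* The factorial term comes from one term of the series of [expR (t / 2)] and
   covers [1 < t]; the summand [1] covers [t <= 1]. *)
pose c : R := 1 + 2 ^+ N.+1 * (N.+1)`!%:R.
have c0 : 0 <= c by rewrite addr_ge0// mulr_ge0// exprn_ge0.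
have c1 : 1 <= c by rewrite lerDl mulr_ge0// exprn_ge0.
have f0 : 0 < (N.+1)`!%:R :> R by rewrite ltr0n fact_gt0.
have bnd t : 0 < t -> t `^ q <= c * expR (t / 2).
  move=> t0.
  have e1 : 1 <= expR (t / 2) by rewrite -[leLHS]expR0 ler_expR; lra.
  have [t1|t1] := leP t 1.
    rewrite (@le_trans _ _ 1)//; last by rewrite -[leLHS]mulr1 ler_pM.
    by rewrite -(powRr0 t) ger_powR// t0.
  apply: (@le_trans _ _ (t ^+ N.+1)).
    by rewrite -powR_mulrn ?(ltW t0)// ler_powR// ltW.
  have := @expR_ge1Dxn R (t / 2) N (divr_ge0 (ltW t0) (ler0n _ 2)).
  rewrite expr_div_n => h.
  have h2 : t ^+ N.+1 / 2 ^+ N.+1 / (N.+1)`!%:R <= expR (t / 2) by lra.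
  have : t ^+ N.+1 <= 2 ^+ N.+1 * (N.+1)`!%:R * expR (t / 2).
    rewrite -ler_pdivrMl ?mulr_gt0 ?exprn_gt0//.
    by rewrite mulrC invfM mulrA.
  by rewrite /c mulrDl mul1r; have := expR_gt0 (t / 2); lra.
have rate0 : 0 < 2^-1 :> R by rewrite invr_gt0.
have I : (@lebesgue_measure R).-integrable `]0, +oo[%classic
    (fun t => (c * 2)%:E * (EFin \o exponential_pdf 2^-1) t)%E.
  apply: integrableZl => //.
  exact: integrableS (integrable_exponential_pdf rate0).
apply: le_integrable I => //.
- apply/measurable_EFinP; apply: measurable_funTS.
  exact: measurable_gamma_integrand.
- move=> t /=; rewrite in_itv/= andbT => t0.
  rewrite lee_fin exponential_pdfE ?(ltW t0)//.
  rewrite !ger0_norm ?gamma_integrand_ge0//; last first.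
    by rewrite !mulr_ge0 ?expR_ge0.
  have -> : - 2^-1 * t = t / 2 + - t by lra.
  rewrite expRD /gamma_integrand !mulrA ler_wpM2r ?expR_ge0//.
  by rewrite (le_trans (bnd _ t0))//; have := expR_gt0 (t / 2); lra.
Qed.

Lemma Rintegral_indic_itvoc {R : realType} (a b : R) : 0 <= a -> a <= b ->
  Rintegral (@lebesgue_measure R) `]0, +oo[%classic \1_(`]a, b]%classic)
    = b - a.
Proof.
move=> a0 ab; rewrite /Rintegral integral_indic//.
rewrite setIidl; last first.
  move=> t /=; rewrite !in_itv/= andbT => /andP[at_ _].
  exact: le_lt_trans at_.
apply: etrans (congr1 fine (lebesgue_measure_itv `]a, b]%R)) _ => /=.
by rewrite lte_fin; case: ltgtP ab => // -> _; rewrite subrr.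
Qed.

Lemma integrable_indic_itvoc {R : realType} (a b : R) :
  (@lebesgue_measure R).-integrable `]0, +oo[%classic
    (EFin \o \1_(`]a, b]%classic)).
Proof. exact: integrableS (integrable_indic_itv a b false false). Qed.

Lemma GammaE {R : realType} (x : R) : Gamma x =
  Rintegral (@lebesgue_measure R) `]0, +oo[%classic (gamma_integrand (x - 1)).
Proof. by []. Qed.

(** On [`]1, 2]] the integrand is at least [e^(-2)]. *)
Lemma Gamma_gt0 {R : realType} (x : R) : 1 <= x -> 0 < Gamma x.
Proof.
move=> x1; have q0 : 0 <= x - 1 by rewrite subr_ge0.
rewrite (@lt_le_trans _ _ (expR (- 2)))// ?expR_gt0// GammaE.
have -> : expR (- 2) = Rintegral (@lebesgue_measure R) `]0, +oo[%classic
    (fun t => expR (- 2) * \1_(`]1, 2]%classic) t).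
  rewrite RintegralZl// ?Rintegral_indic_itvoc ?ler1n//.
    by rewrite (_ : 2 - 1 = 1) ?mulr1//; lra.
  exact: integrable_indic_itvoc.
apply: le_Rintegral => //.
- exact: (integrableZl _ (expR (- 2)) (integrable_indic_itvoc 1 2)).
- exact: integrable_gamma_integrand.
move=> t /=; rewrite in_itv/= andbT => t0.
rewrite indicE mem_setE in_itv/=; have [/andP[t1 t2]|_] := boolP (1 < t <= 2); last first.
  by rewrite mulr0 gamma_integrand_ge0.
rewrite mulr1 /gamma_integrand -[leLHS]mul1r ler_pM ?expR_ge0//.
  by rewrite -[leLHS](powRr0 t) ler_powR// ltW.
by rewrite ler_expR lerN2.
Qed.

(** The choice [q = k alpha] turns [T^q] and [S^q] into [B^k] and [(2 B)^k], so
    the comparison of the negative and positive parts is that of [2^k] with a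
    constant. *)
Lemma Gamma_shift_eventually_ge {R : realType} (alpha B : R) : 0 < alpha -> 0 < B ->
  exists L : nat, forall k : nat, (L <= k)%N ->
    B * Gamma (k%:R * alpha + 1) <= Gamma (k%:R * alpha + 1 + alpha).
Proof.
move=> alpha0 B0.
pose T := B `^ alpha^-1; pose S := (2 * B) `^ alpha^-1.
have B20 : 0 < 2 * B by rewrite mulr_gt0.
have alphaV : alpha^-1 * alpha = 1 by rewrite mulVf// gt_eqF.
have Ta : T `^ alpha = B by rewrite -powRrM alphaV powRr1// ltW.
have Sa : S `^ alpha = 2 * B by rewrite -powRrM alphaV powRr1// ltW.
have T0 : 0 < T by exact: powR_gt0.
have S0 : 0 < S by exact: powR_gt0.
have mono p x y : 0 <= p -> 0 < x -> x <= y -> x `^ p <= y `^ p.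
  by move=> p0 x0 xy; rewrite ge0_ler_powR ?nnegrE// ltW// (lt_le_trans x0).
have TS : T <= S.
  apply: mono; [by rewrite invr_ge0 ltW|exact: B0|].
  by rewrite ler_peMl ?ler1n ?(ltW B0).
pose L := Num.bound (T * expR (S + 1)).
exists L => k Lk; set q := k%:R * alpha.
have q0 : 0 <= q by rewrite mulr_ge0// ltW.
have Tq : T `^ q = B ^+ k.
  by rewrite /q mulrC powRrM Ta powR_mulrn// ltW.
have Sq : S `^ q = (2 * B) ^+ k.
  by rewrite /q mulrC powRrM Sa powR_mulrn// ltW.
have large : T `^ q * T <= expR (- (S + 1)) * S `^ q.
  rewrite Tq Sq exprMn expRN mulrC mulrA ler_pM2r ?exprn_gt0//.
  by rewrite mulrC ler_pdivlMr ?expR_gt0// ltW// upper_nthrootP.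
(* The bound on [t^alpha - B] times the integrand, with negative terms moved
   across so that both sides are integrals of nonnegative functions. *)
have pointwise t : `]0, +oo[%classic t ->
    B * gamma_integrand q t
      + B * (expR (- (S + 1)) * S `^ q) * \1_(`]S, (S + 1)]%classic) t
    <= gamma_integrand (q + alpha) t + B * T `^ q * \1_(`]0, T]%classic) t.
  rewrite /= in_itv/= andbT => t0.
  have -> : gamma_integrand (q + alpha) t = t `^ alpha * gamma_integrand q t.
    rewrite /gamma_integrand powRD; last by rewrite (gt_eqF t0) implybT.
    by rewrite mulrA [t `^ q * _]mulrC.
  have g0 := gamma_integrand_ge0 q t.
  rewrite !indicE !mem_setE !in_itv/= t0/=.
  have [tT|Tt] := leP t T.
    rewrite ltNge (le_trans tT TS)/= mulr0 addr0 mulr1.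
    apply: ler_wpDl; first by rewrite mulr_ge0 ?powR_ge0.
    rewrite ler_pM2l// -[leRHS]mulr1 ler_pM ?powR_ge0 ?expR_ge0//.
      by apply: mono => //; exact: ltW.
    by rewrite -[leRHS]expR0 ler_expR oppr_le0 ltW.
  rewrite mulr0 addr0.
  have [|_] := boolP (S < t <= S + 1); last first.
    by rewrite mulr0 addr0 ler_wpM2r// -Ta; apply: mono; rewrite // ltW.
  move=> /andP[St tS1]; rewrite mulr1.
  have h1 : 2 * B <= t `^ alpha by rewrite -Sa; apply: mono; rewrite // ltW.
  have h2 : expR (- (S + 1)) * S `^ q <= gamma_integrand q t.
    rewrite mulrC ler_pM ?powR_ge0 ?expR_ge0//.
      by apply: mono => //; exact: ltW.
    by rewrite ler_expR lerN2.
  apply: (@le_trans _ _ (2 * B * gamma_integrand q t)).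
    by rewrite -mulrA mulr_natl mulr2n lerD2l ler_pM2l.
  by rewrite ler_wpM2r.
have I1 := integrable_gamma_integrand q q0.
have I2 := integrable_gamma_integrand (q + alpha) (addr_ge0 q0 (ltW alpha0)).
have IZ (c : R) (f : R -> R) :
    (@lebesgue_measure R).-integrable `]0, +oo[%classic (EFin \o f) ->
    (@lebesgue_measure R).-integrable `]0, +oo[%classic
      (EFin \o (fun t => c * f t)).
  by move=> If; exact: (integrableZl _ c If).
have ID (f g : R -> R) :
    (@lebesgue_measure R).-integrable `]0, +oo[%classic (EFin \o f) ->
    (@lebesgue_measure R).-integrable `]0, +oo[%classic (EFin \o g) ->
    (@lebesgue_measure R).-integrable `]0, +oo[%classic
      (EFin \o (fun t => f t + g t)).
  by move=> If Ig; exact: (integrableD _ If Ig).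
have J1 := integrable_indic_itvoc S (S + 1).
have J2 := integrable_indic_itvoc 0 T.
have := @le_Rintegral _ _ _ (@lebesgue_measure R) _ _ _ (measurable_itv _)
  (ID _ _ (IZ B _ I1) (IZ _ _ J1)) (ID _ _ I2 (IZ _ _ J2)) pointwise.
rewrite !RintegralD//; [|exact: IZ..].
rewrite !RintegralZl// !Rintegral_indic_itvoc ?lerDl ?(ltW S0) ?(ltW T0) ?ler01//.
rewrite !GammaE addrK (_ : q + 1 + alpha - 1 = q + alpha); last by ring.
rewrite (_ : S + 1 - S = 1); last by ring.
rewrite subr0 mulr1 -mulrA => H.
rewrite -(lerD2r (B * (T `^ q * T))) (le_trans _ H)// lerD2l.
by rewrite ler_pM2l.
Qed.

Lemma beta_eventually_ge {R : realType} (alpha B : R) :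
  0 < alpha -> 0 < B ->
  exists L : nat, forall l : nat, (L <= l)%N -> B <= beta alpha l.
Proof.
move=> alpha0 B0; have [L HL] := Gamma_shift_eventually_ge alpha B alpha0 B0.
exists L.+1 => -[//|l] Ll; rewrite /beta.
have -> : l.+1%:R * alpha + 1 - alpha = l%:R * alpha + 1.
  by rewrite -natr1; ring.
have -> : l.+1%:R * alpha + 1 = l%:R * alpha + 1 + alpha.
  by rewrite -natr1; ring.
rewrite ler_pdivlMr ?HL//; apply: Gamma_gt0.
by rewrite lerDr mulr_ge0// ltW.
Qed.

(** * Norms of complex matrices *)

Lemma cmx_normE {R : realType} (p q : nat) (B : 'M[R[i]]_(p, q)) :
  `|B| = (cmx_norm B)%:C.
Proof. by rewrite /cmx_norm RRe_real// ger0_real. Qed.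

Lemma cmx_norm_ge0 {R : realType} (p q : nat) (B : 'M[R[i]]_(p, q)) :
  0 <= cmx_norm B.
Proof. by rewrite -lecR -cmx_normE; exact: normr_ge0. Qed.

Lemma cmx_normZ {R : realType} (p q : nat) (c : R) (B : 'M[R[i]]_(p, q)) :
  0 <= c -> cmx_norm (c%:C *: B) = c * cmx_norm B.
Proof.
move=> c0; rewrite {1}/cmx_norm normrZ cmx_normE ger0_norm ?lecR//.
by rewrite -rmorphM.
Qed.

(** The factor [q] is there because the norm is the largest entry, and an entry
    of the product is a sum of [q] terms. *)
Lemma mx_norm_mul {K : numDomainType} (p q r : nat)
    (A : 'M[K]_(p, q)) (B : 'M[K]_(q, r)) :
  `|A *m B| <= q%:R * (`|A| * `|B|).
Proof.
have entry (m n : nat) (C : 'M[K]_(m, n)) i j : `|C i j| <= `|C|.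
  rewrite [leRHS]/Num.norm /= mx_normE -[leLHS]nngE num_le.
  exact: (le_bigmax _ _ (i, j)).
have bound0 : 0 <= q%:R * (`|A| * `|B|) by rewrite !mulr_ge0.
rewrite [leLHS]/Num.norm /=.
have [->//|/mx_norm_neq0[[i j] ->]] := eqVneq (mx_norm (A *m B)) 0.
rewrite mxE (le_trans (ler_norm_sum _ _ _))//.
have -> : q%:R * (`|A| * `|B|) = \sum_(k < q) `|A| * `|B|.
  by rewrite sumr_const card_ord mulr_natl.
by apply: ler_sum => k _; rewrite normrM ler_pM.
Qed.

Lemma cmx_norm_mul {R : realType} (p q r : nat)
    (A : 'M[R[i]]_(p, q)) (B : 'M[R[i]]_(q, r)) :
  cmx_norm (A *m B) <= q%:R * (cmx_norm A * cmx_norm B).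
Proof.
have := mx_norm_mul _ _ _ A B.
by rewrite !cmx_normE -rmorphM -(rmorph_nat (real_complex R)) -rmorphM lecR.
Qed.

(** * From the recursion to convergence *)

(** The rate [2 mu] makes the induction close with the same constant [K]:
    [mu^k (2 mu)^(l-k)] is [2^(-k) (2 mu)^l], and the [2^(-k)] with [k >= 1]
    sum to less than [1].  The finitely many indices below [L], on which nothing
    is assumed, are absorbed in [K]. *)
Lemma geometric_bound_of_convolution {R : realFieldType} (a : nat -> R)
    (mu : R) (L : nat) :
  0 < mu -> (forall l, 0 <= a l) ->
  (forall l, (L <= l)%N -> a l <= \sum_(1 <= k < l.+1) mu ^+ k * a (l - k)%N) ->
  exists K : R, 0 <= K /\ forall l, a l <= K * (2 * mu) ^+ l.
Proof.
move=> mu0 a0 Ha.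
have r0 : 0 < 2 * mu by rewrite mulr_gt0.
pose K := \sum_(k < L) a k / (2 * mu) ^+ k.
have term0 k : 0 <= a k / (2 * mu) ^+ k by rewrite divr_ge0// exprn_ge0 ?ltW.
have K0 : 0 <= K by rewrite sumr_ge0.
exists K; split=> //.
elim/ltn_ind => l IH.
have [lL|Ll] := ltnP l L.
  rewrite -ler_pdivrMr ?exprn_gt0// /K (bigD1 (Ordinal lL))//= lerDl.
  by rewrite sumr_ge0.
apply: (le_trans (Ha _ Ll)).
apply: (@le_trans _ _ (\sum_(1 <= k < l.+1) K * (2 * mu) ^+ l * 2^-1 ^+ k)).
  rewrite big_nat [leRHS]big_nat; apply: ler_sum => k /andP[k1 kl].
  apply: (@le_trans _ _ (mu ^+ k * (K * (2 * mu) ^+ (l - k)))).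
    rewrite ler_pM2l ?exprn_gt0// IH// ltn_subrL k1 (leq_trans k1)//.
  rewrite -[in leRHS](subnK (_ : k <= l)%N)// exprD [(2 * mu) ^+ k]exprMn exprVn.
  rewrite le_eqVlt; apply/orP; left; apply/eqP.
  by field; rewrite expf_neq0// pnatr_eq0.
rewrite -big_distrr/= -[leRHS]mulr1 ler_wpM2l//.
  by rewrite mulr_ge0// exprn_ge0// ltW.
have -> : \sum_(1 <= k < l.+1) (2^-1 : R) ^+ k = 1 - 2^-1 ^+ l.
  elim: {+}l => [|m IHm]; first by rewrite big_geq// expr0 subrr.
  by rewrite big_nat_recr//= IHm exprS; lra.
by rewrite gerBl exprn_ge0// invr_ge0.
Qed.

Theorem proposition2 (R : realType) (alpha : R) (n : nat)
    (A : nat -> 'M[R[i]]_n) (M mu : R) (u : nat -> 'cV[R[i]]_n) :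
  0 < alpha -> alpha < 1 ->
  0 < M -> 0 < mu ->
  (forall m : nat, cmx_norm (A m) <= M * mu ^+ m) ->
  formal_solution alpha A u ->
  exists eps : R, 0 < eps /\
    forall t : R, 0 <= t -> t < eps -> abs_convergent_at alpha u t.
Proof.
move=> alpha0 _ M0 mu0 HA [_ Hu].
pose a l := cmx_norm (u l).
have a0 l : 0 <= a l by exact: cmx_norm_ge0.
pose C := n%:R * M.
have C0 : 0 <= C by rewrite mulr_ge0// ltW.
have AC k v : cmx_norm (A k *m v) <= C * (mu ^+ k * cmx_norm v).
  rewrite (le_trans (cmx_norm_mul _ _ _ _ _))// /C -!mulrA ler_wpM2l//.
  by rewrite mulrA ler_wpM2r ?cmx_norm_ge0.
(* [2 * C] suffices to absorb [A 0] and the factor of the sum; the extra [1]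
   keeps the divisor [C + 1] positive in dimension 0. *)
have [|L HL] := beta_eventually_ge alpha (2 * C + 1) alpha0.
  by rewrite ltr_wpDl ?ltr01// mulr_ge0 ?C0.
have recursion l : (L.+1 <= l)%N ->
    a l <= \sum_(1 <= k < l.+1) mu ^+ k * a (l - k)%N.
  move=> Ll; have l1 : (1 <= l)%N by exact: leq_ltn_trans Ll.
  have b2 := HL l (ltnW Ll); have b0 : 0 <= beta alpha l by lra.
  set S := \sum_(1 <= k < l.+1) _.
  have S0 : 0 <= S by rewrite sumr_ge0// => k _; rewrite mulr_ge0// exprn_ge0 ?ltW.
  have eq_u : (beta alpha l)%:C *: u l =
      A 0%N *m u l + \sum_(1 <= k < l.+1) A k *m u (l - k)%N.
    have := Hu l l1; rewrite mulmxBl mul_scalar_mx => /eqP.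
    by rewrite subr_eq => /eqP->; rewrite addrAC addNr add0r.
  have normD p q (V W : 'M[R[i]]_(p, q)) :
      cmx_norm (V + W) <= cmx_norm V + cmx_norm W.
    by rewrite -lecR rmorphD /= -!cmx_normE ler_normD.
  have normS : cmx_norm (\sum_(1 <= k < l.+1) A k *m u (l - k)%N) <= C * S.
    rewrite /S mulr_sumr.
    elim/big_ind2 : _ => [|x1 x2 y1 y2 h1 h2|k _]; last exact: AC.
      by rewrite /cmx_norm normr0.
    by rewrite (le_trans (normD _ _ _ _))// lerD.
  have bound : beta alpha l * a l <= C * a l + C * S.
    rewrite -cmx_normZ// eq_u (le_trans (normD _ _ _ _))// lerD//.
    by rewrite (le_trans (AC _ _ _))// expr0 mul1r.
  have b2a := ler_wpM2r (a0 l) b2.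
  have C1 : 0 < C + 1 by exact: ltr_wpDl.
  by rewrite -(ler_pM2l C1); lra.
have [K [K0 HK]] := geometric_bound_of_convolution a mu L.+1 mu0 a0 recursion.
have r0 : 0 < 2 * mu by rewrite mulr_gt0.
(* The solution of [2 * mu * eps `^ alpha = 1]. *)
exists ((2 * mu)^-1 `^ alpha^-1); split; first by rewrite powR_gt0 ?invr_gt0.
move=> t t0 teps; rewrite /abs_convergent_at.
have z0 : 0 <= 2 * mu * t `^ alpha by rewrite mulr_ge0 ?powR_ge0 ?ltW.
have z1 : 2 * mu * t `^ alpha < 1.
  rewrite -ltr_pdivlMl// mulr1.
  have <- : (2 * mu)^-1 `^ alpha^-1 `^ alpha = (2 * mu)^-1.
    by rewrite -powRrM mulVf ?gt_eqF// powRr1// invr_ge0 ltW.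
  by rewrite gt0_ltr_powR ?nnegrE ?powR_ge0.
have cvg_geo : cvgn (series (geometric K (2 * mu * t `^ alpha))).
  by apply: is_cvg_geometric_series; rewrite ger0_norm.
apply: (series_le_cvg _ _ _ cvg_geo) => k.
- exact: cmx_norm_ge0.
- by rewrite /= mulr_ge0// exprn_ge0.
- rewrite cmx_normZ ?powR_ge0// powRrM powR_mulrn ?powR_ge0//=.
  rewrite exprMn mulrA mulrC ler_wpM2r ?exprn_ge0 ?powR_ge0//.
  exact: HK.
Qed.
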